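(* For all integers $n\geq 0$, $$p_o(n)+\sum_{j\geq1}(-1)^j\left(p_o(n-j(3j-2))+p_o(n-j(3j+2))\right)=\begin{cases}1,&\text{if $n=3t$ for some triangular number $t$},\\0,&\text{otherwise,}\end{cases}$$ i.e. $p_o(n)-p_o(n-1)-p_o(n-5)+p_o(n-8)+p_o(n-16)-\cdots$ equals $1$ if $n$ is three times a triangular number and $0$ otherwise.
   Context: $p_o(n)$ is the number of partitions of $n$ into odd parts, with $p_o(0)=1$ and $p_o(m)=0$ for $m<0$. A triangular number is an integer of the form $k(k+1)/2$ with $k\ge 0$. *)

(* Defs.v *)
From mathcomp Require Import all_boot all_order all_algebra.
Set Implicit Arguments. Unset Strict Implicit. Unset Printing Implicit Defensive.
Import GRing.Theory Num.Theory.

(* A partition of n into odd parts is encoded by its multiplicity function: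
   m i = number of parts equal to i (i <= n, and each multiplicity is <= n).
   Parts must be odd (hence positive), and sum_i m i * i = n. *)
Definition po_nat (n : nat) : nat :=
  #|[set m : {ffun 'I_n.+1 -> 'I_n.+1} |
      [forall i, (0 < m i)%N ==> odd i] &&
      ((\sum_(i < n.+1) (m i : nat) * (i : nat))%N == n)]|.

Definition p_o (z : int) : int :=
  match z with
  | Posz n => (po_nat n)%:Z
  | Negz _ => 0
  end.

Definition triangular (t : nat) : Prop := exists k : nat, t = (k * k.+1) %/ 2.

(* Main.v *)
(** In terms of generating functions the claim is S / (q;q^2) = T, where
    S = \sum_j (-1)^j q^(3j^2-2j) over all integers j, and
    T = \sum_(k >= 0) q^(3k(k+1)/2) = \sum_j q^(6j^2+3j) over all integers j.
    By Jacobi's triple product S = (q;q^6)(q^5;q^6)(q^6;q^6) and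
    T = (-q^3;q^6)(q^12;q^12). Multiplied by (q^3;q^6), both S / (q;q^2) and T
    become (q^6;q^6). Power series are replaced by polynomials modulo 'X^n, and
    the triple product by its finite form: a sum of Gaussian binomials
    [2m, m + d] which, times (Q;Q)_m, are 1 modulo Q^(m - |d| + 1). *)

Require Import Defs.
From mathcomp Require Import all_boot all_order all_algebra.
From mathcomp Require Import ring zify.
Import GRing.Theory Num.Theory.
Local Open Scope ring_scope.

(** * Congruences modulo an element of a commutative ring *)

Definition eqmod {R : comNzRingType} (d a b : R) := exists c, a = b + d * c.
Definition unitmod {R : comNzRingType} (d a : R) := exists u, eqmod d (u * a) 1.

Section Congruences.
Set Implicit Arguments. Unset Strict Implicit.
Variable R : comNzRingType.
Implicit Types a b c d x y Q : R.

Lemma eqmod_refl d a : eqmod d a a.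
Proof. by exists 0; rewrite mulr0 addr0. Qed.

Lemma eqmod_sym d a b : eqmod d a b -> eqmod d b a.
Proof. by case=> c ->; exists (- c); ring. Qed.

Lemma eqmod_trans d a b c : eqmod d a b -> eqmod d b c -> eqmod d a c.
Proof. by case=> u -> [v ->]; exists (u + v); ring. Qed.

Lemma eqmodD d a b a' b' : eqmod d a b -> eqmod d a' b' -> eqmod d (a + a') (b + b').
Proof. by case=> u -> [v ->]; exists (u + v); ring. Qed.

Lemma eqmodM d a b a' b' : eqmod d a b -> eqmod d a' b' -> eqmod d (a * a') (b * b').
Proof. by case=> u -> [v ->]; exists (u * b' + b * v + d * u * v); ring. Qed.

Lemma eqmodMl d c a b : eqmod d a b -> eqmod d (c * a) (c * b).
Proof. exact/eqmodM/eqmod_refl. Qed.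

Lemma eqmodMr d c a b : eqmod d a b -> eqmod d (a * c) (b * c).
Proof. by move=> H; apply: eqmodM H (eqmod_refl _ _). Qed.

Lemma eqmod_sum d I (r : seq I) (P : pred I) (F G : I -> R) :
  (forall i, P i -> eqmod d (F i) (G i)) ->
  eqmod d (\sum_(i <- r | P i) F i) (\sum_(i <- r | P i) G i).
Proof. by move=> H; elim/big_ind2: _ => //; [exact: eqmod_refl | move=> *; apply: eqmodD]. Qed.

Lemma eqmod_prod d I (r : seq I) (P : pred I) (F G : I -> R) :
  (forall i, P i -> eqmod d (F i) (G i)) ->
  eqmod d (\prod_(i <- r | P i) F i) (\prod_(i <- r | P i) G i).
Proof. by move=> H; elim/big_ind2: _ => //; [exact: eqmod_refl | move=> *; apply: eqmodM]. Qed.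

Lemma eqmodX_weak Q m n a b : (m <= n)%N -> eqmod (Q ^+ n) a b -> eqmod (Q ^+ m) a b.
Proof.
by move=> le_mn [c ->]; exists (Q ^+ (n - m) * c); rewrite mulrA -exprD subnKC.
Qed.

Lemma eqmod_cancel d a x y : unitmod d a -> eqmod d (a * x) (a * y) -> eqmod d x y.
Proof.
(* With [u * a = 1 + d * v], multiplying [a * x = a * y + d * w] by [u] and solving for [x] gives
   this witness. *)
case=> u [v uv] [w axy]; exists (u * w - v * x + v * y).
have ua t : u * (a * t) = t + d * v * t by rewrite mulrA uv; ring.
have := ua x; rewrite axy mulrDr ua => e.
by rewrite -[LHS](addrK (d * v * x)) -e; ring.
Qed.

Lemma unitmod_prod d I (r : seq I) (P : pred I) (F : I -> R) :
  (forall i, P i -> unitmod d (F i)) -> unitmod d (\prod_(i <- r | P i) F i).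
Proof.
move=> H; elim/big_ind: _ => //.
  by exists 1; rewrite mulr1; apply: eqmod_refl.
move=> x y [u ux] [v vy]; exists (u * v).
by rewrite mulrACA -[1]mulr1; apply: eqmodM.
Qed.

(** The truncated geometric series in [Q * x] is an inverse up to the error [(Q * x) ^+ m]. *)
Lemma unitmod_1subM Q m x : unitmod (Q ^+ m) (1 - Q * x).
Proof.
exists (\sum_(i < m) (Q * x) ^+ i), (- x ^+ m).
have := subrX1 (Q * x) m; rewrite exprMn => H.
by rewrite mulrN -[RHS]opprK opprD opprK [- 1 + _]addrC H; ring.
Qed.

Lemma eqmod_prod_widen d m n (P : pred nat) (F : nat -> R) : (m <= n)%N ->
  (forall i, (m <= i)%N -> P i -> eqmod d (F i) 1) ->
  eqmod d (\prod_(0 <= i < n | P i) F i) (\prod_(0 <= i < m | P i) F i).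
Proof.
move=> le_mn H; rewrite (big_cat_nat (leq0n m) le_mn) /=.
rewrite -[X in eqmod _ _ X]mulr1; apply: eqmodMl.
rewrite big_seq_cond; elim/big_ind: _ => [|x y Hx Hy|i].
- exact: eqmod_refl.
- by rewrite -[1]mulr1; apply: eqmodM.
rewrite mem_index_iota => /andP[/andP[le_mi _] Pi].
exact: H.
Qed.

End Congruences.

(** * Gaussian binomials and the Jacobi triple product *)

Section JacobiTripleProduct.
Set Implicit Arguments. Unset Strict Implicit.
Variables (R : comNzRingType) (Q : R).

(** Gaussian binomial coefficients, given by the q-Pascal rule so that no division in [R] is
    needed. *)
Fixpoint qbin (n k : nat) : R :=
  match n, k with
  | _, 0 => 1
  | 0, _.+1 => 0
  | n'.+1, k'.+1 => qbin n' k' + Q ^+ k * qbin n' k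
  end.

(** The q-Pochhammer symbol (Q;Q)_n. *)
Definition qfact (n : nat) : R := \prod_(0 <= i < n) (1 - Q ^+ i.+1).

Lemma qbin0 n : qbin n 0 = 1. Proof. by case: n. Qed.

Lemma qbinS n k : qbin n.+1 k.+1 = qbin n k + Q ^+ k.+1 * qbin n k.+1.
Proof. by []. Qed.

Lemma qbin_small n k : (n < k)%N -> qbin n k = 0.
Proof.
elim: n k => [|n IH] [|k] //= lt_nk.
by rewrite !IH ?mulr0 ?addr0 //; lia.
Qed.

Lemma qfactS n : qfact n.+1 = qfact n * (1 - Q ^+ n.+1).
Proof. by rewrite /qfact big_nat_recr. Qed.

(** In the induction the two Pascal terms contribute [qfact n] times [1 - Q ^+ k.+1] and
    [Q ^+ k.+1 - Q ^+ n.+1]. *)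
Lemma qbin_qfact n k : (k <= n)%N -> qbin n k * qfact k * qfact (n - k) = qfact n.
Proof.
elim: n k => [|n IH] [|k] le_kn //.
- by rewrite /qfact !big_geq // !mulr1.
- by rewrite qbin0 subn0 /qfact [X in _ * X * _]big_geq // !mul1r.
rewrite qbinS subSS ltnS in le_kn *; rewrite mulrDl mulrDl [qfact k.+1]qfactS.
have -> : qbin n k * (qfact k * (1 - Q ^+ k.+1)) * qfact (n - k)
   = qfact n * (1 - Q ^+ k.+1) by rewrite -(IH _ le_kn); ring.
case: (ltngtP k n) le_kn => // [lt_kn|->] _; last first.
  by rewrite (qbin_small (ltnSn n)) mulr0 !mul0r addr0 qfactS.
have := IH _ lt_kn; rewrite qfactS => IHk.
have -> : (n - k)%N = (n - k.+1).+1 by lia.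
rewrite qfactS; have -> : (n - k.+1).+1 = (n - k)%N by lia.
have -> : Q ^+ k.+1 * qbin n k.+1 * (qfact k * (1 - Q ^+ k.+1)) *
   (qfact (n - k.+1) * (1 - Q ^+ (n - k)))
   = qfact n * (Q ^+ k.+1 - Q ^+ k.+1 * Q ^+ (n - k)) by rewrite -IHk; ring.
by rewrite -exprD addSn subnKC ?(ltnW lt_kn) // qfactS; ring.
Qed.

Lemma qfact_eqmod m n : (m <= n)%N -> eqmod (Q ^+ m.+1) (qfact n) (qfact m).
Proof.
move=> le_mn; apply: eqmod_prod_widen => // i le_mi _.
exists (- Q ^+ (i - m)); rewrite mulrN -exprD; congr (1 - _ ^+ _); lia.
Qed.

Lemma unitmod_qfact m n : unitmod (Q ^+ m) (qfact n).
Proof. by apply: unitmod_prod => i _; rewrite exprS; apply: unitmod_1subM. Qed.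

(** By [qbin_qfact], multiplying the left side by [qfact k * qfact (m.*2 - k)] gives
    [qfact m * qfact m.*2]. All four indices are at least s = min(k, 2m - k), so modulo [Q ^+ s.+1]
    each of these factors is the unit [qfact s], which cancels. *)
Lemma qbin_limit m k : (k <= m.*2)%N ->
  eqmod (Q ^+ (minn k (m.*2 - k)).+1) (qfact m * qbin m.*2 k) 1.
Proof.
move=> le_k; set s := minn _ _; set U := qfact s.
have E n : (s <= n)%N -> eqmod (Q ^+ s.+1) (qfact n) U by apply: qfact_eqmod.
have uU := unitmod_qfact s.+1 s.
apply: (eqmod_cancel uU); apply: (eqmod_cancel uU).
apply: (@eqmod_trans _ _ _ (qfact m * qfact m.*2)); last first.
  by rewrite mulr1; apply: eqmodM; apply: E; lia.
rewrite -[X in eqmod _ _ (_ * X)](qbin_qfact le_k).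
have -> : qfact m * (qbin m.*2 k * qfact k * qfact (m.*2 - k))
  = qfact k * (qfact (m.*2 - k) * (qfact m * qbin m.*2 k)) by ring.
by apply/eqmod_sym/eqmodM; [apply: E; lia | apply: eqmodMr; apply: E; lia].
Qed.

Lemma binS2 d : 'C(d.+1, 2) = ('C(d, 2) + d)%N.
Proof. by rewrite binS bin1. Qed.

(** Pascal's rule in summed form, the common induction step of the q-binomial theorem and the finite
    triple product. *)
Lemma sum_qbin_pascal (F : nat -> R) n :
  \sum_(k < n.+1) qbin n k * (F k.+1 + Q ^+ k * F k)
  = \sum_(k < n.+2) qbin n.+1 k * F k.
Proof.
rewrite [RHS]big_ord_recl /= mul1r.
under [X in _ = _ + X]eq_bigr do rewrite /bump /= add1n mulrDl.
rewrite big_split /= addrCA.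
under eq_bigr do rewrite mulrDr.
rewrite big_split /=; congr (_ + _).
rewrite big_ord_recl [in RHS]big_ord_recr /= qbin0 (qbin_small (ltnSn n)).
rewrite expr0 !mul1r mulr0 mul0r addr0; congr (_ + _).
by apply: eq_bigr => i _; rewrite /bump /= add1n; ring.
Qed.

(** Removing the factor for [i = 0] leaves the same product with [z * Q] for [z], hence the
    induction over all [z]. *)
Lemma qbinomial_theorem n (z : R) :
  \prod_(0 <= i < n) (1 + z * Q ^+ i)
  = \sum_(k < n.+1) qbin n k * (z ^+ k * Q ^+ 'C(k, 2)).
Proof.
elim: n z => [|n IH] z; first by rewrite big_geq // big_ord1 /= !expr0 !mulr1.
rewrite big_nat_recl //= expr0 mulr1.
under eq_bigr do rewrite exprS mulrA.
rewrite IH mulr_sumr -(sum_qbin_pascal (fun k => z ^+ k * Q ^+ 'C(k, 2))).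
by apply: eq_bigr => k _; rewrite binS2 exprMn exprS exprD; ring.
Qed.

Variables z w : R.
Hypothesis zwQ : z * w = Q.

(* [jterm k m] is z^d Q^(d(d-1)/2) for d = k - m in Z, where w = Q / z. *)
Definition jterm (k m : nat) : R :=
  if (m <= k)%N then z ^+ (k - m) * Q ^+ 'C(k - m, 2)
  else w ^+ (m - k) * Q ^+ 'C(m - k, 2).

Lemma jtermSS k m : jterm k.+1 m.+1 = jterm k m.
Proof. by rewrite /jterm ltnS !subSS. Qed.

(** Lowering d = k - m by one divides the term by z Q^(d-1). Since [z] need not be invertible, the
    sign of d is treated by cases. *)
Lemma jtermMw k m : jterm k m * (w * Q ^+ m) = Q ^+ k * jterm k m.+1.
Proof.
rewrite /jterm; case: (ltngtP m k) => [lt_mk|lt_km|->].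
- have [-> ->] : (k - m = (k - m.+1).+1 /\ Q ^+ k = Q ^+ (m + (k - m.+1).+1))%N.
    by split; [lia | congr (_ ^+ _); lia].
  by rewrite binS2 exprS exprD [Q ^+ (m + _)]exprD [Q ^+ _.+1]exprS -zwQ; ring.
- rewrite subSn ?(ltnW lt_km) // binS2 exprS exprD.
  have -> : Q ^+ m = Q ^+ k * Q ^+ (m - k) by rewrite -exprD subnKC // ltnW.
  ring.
- by rewrite subnn subSnn /= !expr0 expr1; ring.
Qed.

(** Induction on [m] from the q-binomial theorem: by [jtermMw] the new factor [1 + w * Q ^+ m]
    produces the weights of [sum_qbin_pascal]. *)
Lemma finite_triple_product n m :
  \prod_(0 <= i < n) (1 + z * Q ^+ i) * \prod_(0 <= i < m) (1 + w * Q ^+ i)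
  = \sum_(k < (m + n).+1) qbin (m + n) k * jterm k m.
Proof.
elim: m => [|m IH]; last first.
  rewrite big_nat_recr //= mulrA IH addSn.
  rewrite -(sum_qbin_pascal (jterm^~ m.+1)) mulr_suml.
  by apply: eq_bigr => k _; rewrite jtermSS -jtermMw; ring.
rewrite [X in _ * X]big_geq // mulr1 qbinomial_theorem.
by apply: eq_bigr => k _; rewrite /jterm leq0n subn0.
Qed.

Lemma triple_product_eqmod m :
  eqmod (Q ^+ m)
    (\prod_(0 <= i < m) ((1 + z * Q ^+ i) * (1 + w * Q ^+ i) * (1 - Q ^+ i.+1)))
    (\sum_(k < m.*2.+1) jterm k m).
Proof.
rewrite !big_split /= finite_triple_product addnn mulrC mulr_sumr.
apply: eqmod_sum => -[k /= le_k] _; rewrite mulrA.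
have [c ->] := qbin_limit le_k.
rewrite ltnS in le_k; set s := minn _ _.
have [x ->] : exists x, jterm k m = Q ^+ 'C(m - s, 2) * x.
  rewrite /jterm; case: leqP => H.
    by exists (z ^+ (k - m)); rewrite mulrC; congr (_ ^+ 'C(_, _) * _); lia.
  by exists (w ^+ (m - k)); rewrite mulrC; congr (_ ^+ 'C(_, _) * _); lia.
(* Here |d| = m - s. The power of [Q] in [jterm] makes up for the precision lost in [qbin_limit],
   because |d| <= C(|d|, 2) + 1. *)
have le_m : (m <= 'C(m - s, 2) + s.+1)%N.
  have : (m - s <= ('C(m - s, 2)).+1)%N.
    by elim: (m - s)%N => // d IHd; rewrite binS2; lia.
  lia.
apply: (eqmodX_weak le_m); exists (c * x); rewrite exprD; ring.
Qed.

(** The indices d = j and d = -j are paired around d = 0; raising [m] by one adds one term at each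
    end. *)
Lemma sum_jterm m :
  \sum_(k < m.*2.+1) jterm k m
  = 1 + \sum_(1 <= j < m.+1) (z ^+ j + w ^+ j) * Q ^+ 'C(j, 2).
Proof.
elim: m => [|m IH].
  by rewrite big_ord1 big_geq // /jterm /= !expr0; ring.
rewrite big_nat_recr //= doubleS big_ord_recl big_ord_recr /=.
under eq_bigr do rewrite /bump /= add1n jtermSS.
rewrite IH /bump /= add1n jtermSS /jterm /= subn0.
have -> : (m <= m.*2.+1)%N by lia.
have -> : (m.*2.+1 - m = m.+1)%N by lia.
ring.
Qed.

End JacobiTripleProduct.

(** * Generating function of partitions into odd parts *)

Section OddPartitions.
Set Implicit Arguments. Unset Strict Implicit.
Implicit Types p q : {poly int}.

Lemma eqmodXn_coef n i p q : (i < n)%N -> eqmod 'X^n p q -> p`_i = q`_i.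
Proof. by move=> lt_in [c ->]; rewrite coefD coefXnM lt_in addr0. Qed.

Lemma eqmodXn_1 n m : (n <= m)%N -> eqmod ('X^n : {poly int}) (1 - 'X^m) 1.
Proof.
by move=> le_nm; exists (- 'X^(m - n)); rewrite mulrN -exprD subnKC.
Qed.

Lemma unitmodXn n m : (0 < m)%N -> unitmod ('X^n : {poly int}) (1 - 'X^m).
Proof. by case: m => // m _; rewrite [X in _ - X]exprS; apply: unitmod_1subM. Qed.

Definition odd_gf n : {poly int} :=
  \prod_(0 <= i < n | odd i) \sum_(j < n) 'X^(i * j).

Lemma coef_odd_gf_diag n : (odd_gf n.+1)`_n = (po_nat n)%:Z.
Proof.
rewrite /odd_gf big_mkord big_mkcond /=.
(* An even [i] admits only multiplicity 0, whose term is 1, so the product may run over all [i].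
   Expanding it then gives a sum over multiplicity functions. *)
pose P (i j : 'I_n.+1) := (0 < j)%N ==> odd i.
rewrite (eq_bigr (fun i : 'I_n.+1 => \sum_(j | P i j) ('X^(i * j) : {poly int}))).
  rewrite bigA_distr_big_dep /= coef_sum.
  rewrite (eq_bigr (fun f : {ffun 'I_n.+1 -> 'I_n.+1} =>
     ((\sum_(i < n.+1) f i * i == n)%N : nat)%:Z)); last first.
    move=> f _; rewrite -(big_morph _ (fun x y => exprD 'X x y) (expr0 _)) coefXn eq_sym.
    by rewrite natz; under eq_bigr do rewrite mulnC.
  rewrite -(big_morph Posz PoszD (erefl _)); congr Posz.
  rewrite /po_nat -sum1dep_card [LHS]big_mkcond [RHS]big_mkcond /=.
  apply: eq_bigr => f _; rewrite -[f \in _]/([forall i, P i (f i)]).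
  by case: [forall i, _] => //=; case: eqP.
move=> i _; rewrite /P; case: (odd i).
  by apply: eq_bigl => j; rewrite implybT.
rewrite (big_pred1 ord0) ?muln0 ?expr0 // => j.
by rewrite implybF lt0n negbK.
Qed.

(** Each geometric sum times [1 - 'X^i] is [1 - 'X^(i * n)] with [i] odd, hence positive. The
    factors with [i >= n] are already 1 modulo ['X^n]. *)
Lemma odd_gf_inv n m : (n <= m)%N ->
  eqmod 'X^n (odd_gf n * \prod_(0 <= i < m | odd i) (1 - 'X^i)) 1.
Proof.
move=> le_nm.
apply: (@eqmod_trans _ _ _ (odd_gf n * \prod_(0 <= i < n | odd i) (1 - 'X^i))).
  apply: eqmodMl; apply: eqmod_prod_widen => // i le_ni _; exact: eqmodXn_1.
rewrite /odd_gf -big_split /=.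
rewrite -[X in eqmod _ _ X](big1_eq (op := *%R) (index_iota 0 n) odd).
apply: eqmod_prod => i odd_i.
have -> : (\sum_(j < n) 'X^(i * j)) * (1 - 'X^i) = 1 - 'X^(i * n) :> {poly int}.
  under eq_bigr do rewrite exprM.
  by rewrite exprM -opprB mulrN mulrC -subrX1 opprB.
by apply: eqmodXn_1; case: i odd_i => // i _; rewrite mulSn leq_addr.
Qed.

(** The truncations [odd_gf i.+1] and [odd_gf n.+1] invert the same product modulo ['X^(i.+1)],
    which reduces the claim to the diagonal case. *)
Lemma coef_odd_gf i n : (i <= n)%N -> (odd_gf n.+1)`_i = (po_nat i)%:Z.
Proof.
move=> le_in; rewrite -coef_odd_gf_diag.
apply: (@eqmodXn_coef i.+1) => //.
have uO : unitmod ('X^(i.+1) : {poly int}) (\prod_(0 <= j < n.+1 | odd j) (1 - 'X^j)).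
  by apply: unitmod_prod => j odd_j; apply: unitmodXn; case: j odd_j.
apply: (eqmod_cancel uO); rewrite ![_ * odd_gf _]mulrC.
apply: (@eqmod_trans _ _ _ 1); last by apply/eqmod_sym/odd_gf_inv.
by apply: (@eqmodX_weak _ _ _ n.+1) => //; apply: odd_gf_inv.
Qed.

(** * Octagonal and triangular series as products *)

Lemma prod_nat_double (F : nat -> {poly int}) m :
  \prod_(0 <= i < m.*2) F i = \prod_(0 <= i < m) (F i.*2 * F i.*2.+1).
Proof.
elim: m => [|m IH]; first by rewrite !big_geq.
by rewrite doubleS !big_nat_recr //= IH mulrA.
Qed.

Lemma prod_odd_mod6 (F : nat -> {poly int}) m :
  \prod_(0 <= i < 6 * m | odd i) F i
  = \prod_(0 <= i < m) (F (6 * i + 1)%N * F (6 * i + 3)%N * F (6 * i + 5)%N).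
Proof.
elim: m => [|m IH]; first by rewrite !big_geq.
rewrite [RHS]big_nat_recr //= -IH mulnS addnC !addnS addn0.
rewrite big_mkcond !big_nat_recr //= -big_mkcond /=.
have -> : odd (6 * m) = false by lia.
by rewrite /= !mulr1 !mulrA.
Qed.

Lemma bin2_double j : ('C(j, 2) * 2 = j * j.-1)%N.
Proof. by elim: j => [|[|j] IH] //; rewrite binS2 mulnDl IH /=; lia. Qed.

(** The exponents are the generalized octagonal numbers; the natural subtraction is exact since
    [j >= 1]. *)
Definition octagonal_sum m : {poly int} :=
  1 + \sum_(1 <= j < m.+1) (-1) ^+ j * ('X^(j * (3 * j - 2)) + 'X^(j * (3 * j + 2))).

Definition triangular_sum m : {poly int} :=
  \sum_(0 <= k < m) 'X^(3 * ((k * k.+1) %/ 2)).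

(** The triple product with Q = X^6, z = -X and w = -X^5. *)
Lemma octagonal_sum_product m :
  eqmod 'X^(6 * m)
    (\prod_(0 <= i < m) ((1 - 'X^(6 * i + 1)) * (1 - 'X^(6 * i + 5)) * (1 - 'X^(6 * i + 6))))
    (octagonal_sum m).
Proof.
have zw : (- 'X) * (- 'X^5) = 'X^6 :> {poly int} by rewrite mulrNN -exprS.
have := triple_product_eqmod zw m; rewrite sum_jterm.
rewrite -exprM.
have -> : octagonal_sum m = 1 + \sum_(1 <= j < m.+1)
   ((- 'X) ^+ j + (- 'X^5) ^+ j) * 'X^6 ^+ 'C(j, 2).
  congr (_ + _); apply: eq_big_nat => j /andP[j_gt0 _].
  rewrite (exprNn 'X) (exprNn 'X^5) -!exprM -mulrDr -mulrA mulrDl -!exprD.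
  have e := bin2_double j.
  congr (_ * ('X^_ + 'X^_)); nia.
congr eqmod; apply: eq_bigr => i _.
rewrite -!exprM !mulNr -exprS -exprD; congr ((1 - 'X^_) * (1 - 'X^_) * (1 - 'X^_)); lia.
Qed.

(** The triple product with Q = X^12, z = X^3 and w = X^9; the terms with z^j and w^j give the
    triangular numbers of index 2j - 1 and 2j. *)
Lemma triangular_sum_product m :
  eqmod 'X^(12 * m)
    (\prod_(0 <= i < m)
       ((1 + 'X^(12 * i + 3)) * (1 + 'X^(12 * i + 9)) * (1 - 'X^(12 * i + 12))))
    (triangular_sum m.*2.+1).
Proof.
have zw : 'X^3 * 'X^9 = 'X^12 :> {poly int} by rewrite -exprD.
have := triple_product_eqmod zw m; rewrite sum_jterm -exprM.
have <- : triangular_sum m.*2.+1 = 1 + \sum_(1 <= j < m.+1)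
   ('X^3 ^+ j + 'X^9 ^+ j) * 'X^12 ^+ 'C(j, 2).
  elim: m => [|m IH]; first by rewrite /triangular_sum big_nat1 big_geq // addr0.
  rewrite big_nat_recr // addrA -IH /triangular_sum doubleS.
  rewrite !(@big_nat_recr _ _ _ _.+1) //= -addrA; congr (_ + _).
  rewrite mulrDl -!exprM -!exprD.
  have /= e := bin2_double m.+1.
  congr ('X^_ + 'X^_); nia.
congr eqmod; apply: eq_bigr => i _.
rewrite -!exprM -!exprD; congr ((1 + 'X^_) * (1 + 'X^_) * (1 - 'X^_)); lia.
Qed.

Lemma odd_gf_octagonal n m : (n <= m)%N ->
  eqmod 'X^n (odd_gf n * octagonal_sum m.*2) (triangular_sum m.*2.+1).
Proof.
move=> le_nm.
pose D : {poly int} := \prod_(0 <= i < m.*2) (1 - 'X^(6 * i + 3)).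
pose E : {poly int} := \prod_(0 <= i < m.*2) (1 - 'X^(6 * i + 6)).
have uD : unitmod 'X^n D by apply: unitmod_prod => i _; apply: unitmodXn; lia.
apply: (eqmod_cancel uD); apply: (@eqmod_trans _ _ _ E).
  rewrite -[X in eqmod _ _ X]mul1r mulrCA.
  apply: (@eqmod_trans _ _ _ (odd_gf n * \prod_(0 <= i < 6 * m.*2 | odd i) (1 - 'X^i) * E)).
    rewrite -mulrA; apply: eqmodMl.
    (* Among the odd residues modulo 6, the classes 1 and 5 come from the octagonal product and the
       class 3 from [D]. *)
    rewrite prod_odd_mod6 /E -big_split /=.
    have /eqmod_sym HS := octagonal_sum_product m.*2.
    apply: eqmod_trans (eqmodMl D (eqmodX_weak _ HS)) _; first by lia.
    rewrite /D -big_split /=.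
    under eq_bigr do rewrite mulrA mulrA [X in X * _ * _]mulrC -!mulrA.
    under [X in eqmod _ _ X]eq_bigr do rewrite -!mulrA.
    exact: eqmod_refl.
  by apply: eqmodMr; apply: odd_gf_inv; lia.
have /eqmod_sym HS := triangular_sum_product m.
apply/eqmod_sym.
apply: eqmod_trans (eqmodMl D (eqmodX_weak _ HS)) _; first by lia.
pose A k : {poly int} := \prod_(0 <= i < k) (1 - 'X^(12 * i + 6)).
pose B : {poly int} := \prod_(0 <= i < m) (1 - 'X^(12 * i + 12)).
have -> : E = A m * B.
  rewrite /E prod_nat_double -big_split /=; apply: eq_bigr => i _.
  by congr ((1 - 'X^_) * (1 - 'X^_)); lia.
(* Each factor [1 - 'X^a] of [D] meets [1 + 'X^a] and yields [1 - 'X^(a * 2)]. *)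
have -> : D * \prod_(0 <= i < m)
   ((1 + 'X^(12 * i + 3)) * (1 + 'X^(12 * i + 9)) * (1 - 'X^(12 * i + 12))) = A m.*2 * B.
  rewrite /D /A !prod_nat_double -!big_split /=; apply: eq_bigr => i _.
  have -> : (6 * i.*2 + 3 = 12 * i + 3)%N by lia.
  have -> : (6 * i.*2.+1 + 3 = 12 * i + 9)%N by lia.
  have -> : (12 * i.*2 + 6 = (12 * i + 3) * 2)%N by lia.
  have -> : (12 * i.*2.+1 + 6 = (12 * i + 9) * 2)%N by lia.
  by rewrite !exprM; ring.
(* [A m.*2] and [A m] differ only by factors [1 - 'X^(12 * i + 6)] with [i >= m >= n]. *)
apply: eqmodMr; apply: eqmod_prod_widen => [|i le_i _]; first by lia.
by apply: eqmodXn_1; lia.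
Qed.

(** * Comparison of coefficients *)

Lemma coef_odd_gf_Xn n k :
  (odd_gf n.+1 * 'X^k)`_n = p_o (n%:Z - k%:Z).
Proof.
rewrite coefMXn; case: ltnP => [lt_nk|le_kn].
  by case e : (n%:Z - k%:Z) => [a|a] //; lia.
by rewrite subzn // coef_odd_gf // leq_subr.
Qed.

Lemma coef_odd_gf_octagonal n m : (n <= m)%N ->
  (odd_gf n.+1 * octagonal_sum m)`_n
  = p_o n%:Z + \sum_(1 <= j < n.+1)
      (-1) ^+ j * (p_o (n%:Z - j%:Z * (3 * j%:Z - 2))
                   + p_o (n%:Z - j%:Z * (3 * j%:Z + 2))).
Proof.
move=> le_nm; rewrite mulrDr mulr1 coefD coef_odd_gf // mulr_sumr coef_sum.
congr (_ + _); rewrite (@big_cat_nat _ _ _ n.+1) //= [X in _ + X]big1_seq ?addr0.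
  apply: eq_big_nat => j /andP[j_gt0 _].
  have -> : (-1) ^+ j = ((-1) ^+ j)%:P :> {poly int} by rewrite polyC_exp polyCN.
  rewrite mulrCA coefCM mulrDr coefD !coef_odd_gf_Xn.
  by rewrite !PoszM -subzn; last lia; rewrite PoszD !PoszM.
(* For [j > n] both exponents exceed [n], so these terms do not reach coefficient [n]. *)
move=> j /andP[_]; rewrite mem_index_iota => /andP[lt_nj _].
have -> : (-1) ^+ j = ((-1) ^+ j)%:P :> {poly int} by rewrite polyC_exp polyCN.
rewrite mulrCA coefCM mulrDr coefD !coefMXn.
have -> : (n < j * (3 * j - 2))%N by nia.
have -> : (n < j * (3 * j + 2))%N by nia.
by rewrite addr0 mulr0.
Qed.

Lemma coef_triangular_sum n m :
  (triangular_sum m)`_n = \sum_(0 <= k < m) (n == 3 * ((k * k.+1) %/ 2))%N%:R.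
Proof. by rewrite coef_sum; apply: eq_bigr => k _; rewrite coefXn. Qed.

(** For a < b the products a(a+1) and b(b+1) differ by at least 2, so their halves differ. *)
Lemma triangle_inj : injective (fun k => (k * k.+1) %/ 2)%N.
Proof.
move=> a b /= e; case: (ltngtP a b) => // H; exfalso.
  have : (a * a.+1 + 2 <= b * b.+1)%N by nia.
  lia.
have : (b * b.+1 + 2 <= a * a.+1)%N by nia.
lia.
Qed.

End OddPartitions.

(* The sum over j >= 1 is finite: for j > n both arguments are negative
   (p_o vanishes there), so we sum over 1 <= j <= n. *)
Theorem theorem6 (n : nat) :
  let S := p_o n%:Z + \sum_(1 <= j < n.+1)
      (-1) ^+ j * (p_o (n%:Z - j%:Z * (3 * j%:Z - 2))
                   + p_o (n%:Z - j%:Z * (3 * j%:Z + 2))) in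
  ((exists t : nat, triangular t /\ n = (3 * t)%N) -> S = 1) /\
  (~ (exists t : nat, triangular t /\ n = (3 * t)%N) -> S = 0).
Proof.
move=> S.
(* Coefficient [n] needs the congruence modulo ['X^(n.+1)], hence the truncations at [n.+1]. *)
have -> : S = \sum_(0 <= k < n.+1.*2.+1) (n == 3 * ((k * k.+1) %/ 2))%N%:R.
  rewrite /S -coef_triangular_sum -(coef_odd_gf_octagonal (m := n.+1.*2)); last by lia.
  by apply: (@eqmodXn_coef n.+1) => //; apply: odd_gf_octagonal.
split=> [[_ [[k ->] ->]] | no_t].
  set T := (_ %/ _)%N.
  (* The index [k] lies in the range of summation, and by injectivity no other index contributes. *)
  rewrite (bigD1_seq k) ?iota_uniq ?mem_index_iota //=; last by rewrite /T; nia.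
  rewrite eqxx big1 ?addr0 // => j /eqP ne_jk; case: eqP => //= eT.
  by case: ne_jk; apply: triangle_inj; rewrite /= -/T; lia.
apply: big1 => k _; case: eqP => // e; case: no_t.
by exists ((k * k.+1) %/ 2)%N; split => //; exists k.
Qed.
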